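(* Let $q$ be a prime power and $m$ a positive integer. For $i\in\{1,2\}$ let $\mathcal{C}_i$ be a nondegenerate $[n_i,k_i]_{q^m/q}$ code and let $\mathcal{U}_i$ be an associated $[n_i,k_i]_{q^m/q}$ system which is rank-$\rho_i$-saturating. Let $f:\mathbb{F}_{q^m}^{1\times n_1}\to\mathbb{F}_{q^m}^{1\times n_2}$ be an $\mathbb{F}_{q^m}$-linear map. Then the $f$-sum $\mathcal{U}_1\oplus_f\mathcal{U}_2$ is an $[n_1+n_2,k_1+k_2]_{q^m/q}$ system that is rank-$\rho$-saturating for some $\rho\le\rho_1+\rho_2$. In particular, if $\rho_1+\rho_2\le\min\{k_1+k_2,m\}$, then \[s_{q^m/q}(k_1+k_2,\rho_1+\rho_2)\le s_{q^m/q}(k_1,\rho_1)+s_{q^m/q}(k_2,\rho_2).\]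
   Context: An $[n,k]_{q^m/q}$ code is a $k$-dimensional $\mathbb{F}_{q^m}$-subspace of $\mathbb{F}_{q^m}^{1\times n}$; nondegenerate means the columns of a generator matrix span an $n$-dimensional $\mathbb{F}_q$-space. An $[n,k]_{q^m/q}$ system is an $n$-dimensional $\mathbb{F}_q$-subspace $\mathcal{U}\le\mathbb{F}_{q^m}^k$ with $\langle\mathcal{U}\rangle_{\mathbb{F}_{q^m}}=\mathbb{F}_{q^m}^k$; a system associated with a code is the $\mathbb{F}_q$-span of the columns of one of its generator matrices (well-defined up to the action of $\mathrm{GL}_k(q^m)$). The $f$-sum of $\mathcal{C}_1,\mathcal{C}_2$ is the code $\mathcal{C}=\{(u,f(u)+v):u\in\mathcal{C}_1,v\in\mathcal{C}_2\}\le\mathbb{F}_{q^m}^{1\times(n_1+n_2)}$, and $\mathcal{U}_1\oplus_f\mathcal{U}_2$ denotes a system associated with $\mathcal{C}$. The linear set of $\mathcal{U}$ is $L_\mathcal{U}=\{\langle u\rangle_{\mathbb{F}_{q^m}}:u\in\mathcal{U}\setminus\{0\}\}\subseteq\mathrm{PG}(k-1,q^m)$; a point set is $r$-saturating if every point of $\mathrm{PG}(k-1,q^m)$ lies in the span of some $r+1$ of its points and $r$ is minimal with this property; $\mathcal{U}$ is rank-$\rho$-saturating if $L_\mathcal{U}$ is $(\rho-1)$-saturating. For $\rho\in\{1,\ldots,\min\{k,m\}\}$, $s_{q^m/q}(k,\rho)$ is the minimum $n$ such that an $[n,k]_{q^m/q}$ rank-$\rho$-saturating system exists. *)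

(* Defs.v *)
From HB Require Import structures.
From mathcomp Require Import all_boot all_order all_algebra all_field.

Set Implicit Arguments.
Unset Strict Implicit.
Unset Printing Implicit Defensive.

Import GRing.Theory.
Local Open Scope ring_scope.

(* F is the field of order q and L its extension of degree m.  The space L^k
   is used in two forms: {ffun 'I_k -> L}, whose canonical vector space
   structure is the one over F, for systems; and 'cV[L]_k, whose structure is
   the one over L, for projective points and L-spans. *)
Section RankMetric.
Variables (F : finFieldType) (L : fieldExtType F).

Definition colvec (k : nat) (u : {ffun 'I_k -> L}) : 'cV[L]_k :=
  \col_i u i.

Definition generator_matrix (n k : nat) (C : {vspace 'rV[L]_n})
    (G : 'M[L]_(k, n)) : Prop :=
  basis_of C [seq row i G | i : 'I_k].

Definition column_space (n k : nat) (G : 'M[L]_(k, n)) :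
    {vspace {ffun 'I_k -> L}} :=
  <<[seq [ffun i => G i j] | j : 'I_n]>>%VS.

Definition is_code (n k : nat) (C : {vspace 'rV[L]_n}) : Prop := \dim C = k.

Definition nondegenerate_code (n k : nat) (C : {vspace 'rV[L]_n}) : Prop :=
  exists G : 'M[L]_(k, n), generator_matrix C G /\ \dim (column_space G) = n.

Definition is_system (n k : nat) (U : {vspace {ffun 'I_k -> L}}) : Prop :=
  \dim U = n /\
  forall x : 'cV[L]_k, exists s : seq {ffun 'I_k -> L},
    {subset s <= U} /\ x \in <<map (@colvec k) s>>%VS.

Definition associated_system (n k : nat) (C : {vspace 'rV[L]_n})
    (U : {vspace {ffun 'I_k -> L}}) : Prop :=
  exists G : 'M[L]_(k, n), generator_matrix C G /\ U = column_space G.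

(* Points of PG(k-1, q^m) are the W : {vspace 'cV[L]_k} with \dim W = 1. *)
Definition linear_set (k : nat) (U : {vspace {ffun 'I_k -> L}})
    (W : {vspace 'cV[L]_k}) : Prop :=
  exists u, [/\ u \in U, u != 0 & W = <[colvec u]>%VS].

Definition covers (k r : nat) (S : {vspace 'cV[L]_k} -> Prop) : Prop :=
  forall W : {vspace 'cV[L]_k}, \dim W = 1%N ->
  exists t : r.+1.-tuple {vspace 'cV[L]_k},
    [/\ uniq t, forall Q, Q \in t -> S Q & (W <= \sum_(Q <- t) Q)%VS].

Definition saturating (k r : nat) (S : {vspace 'cV[L]_k} -> Prop) : Prop :=
  covers r S /\ forall r', covers r' S -> (r <= r')%N.

Definition rank_saturating (k rho : nat) (U : {vspace {ffun 'I_k -> L}}) :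
    Prop :=
  (0 < rho)%N /\ saturating rho.-1 (linear_set U).

(* s_{q^m/q}(k, rho) = n *)
Definition is_min_saturating (k rho n : nat) : Prop :=
  (exists U : {vspace {ffun 'I_k -> L}},
     is_system n U /\ rank_saturating rho U) /\
  forall (n' : nat) (U : {vspace {ffun 'I_k -> L}}),
    is_system n' U -> rank_saturating rho U -> (n <= n')%N.

Definition fsum (n1 n2 : nat) (f : {linear 'rV[L]_n1 -> 'rV[L]_n2})
    (C1 : {vspace 'rV[L]_n1}) (C2 : {vspace 'rV[L]_n2}) :
    {vspace 'rV[L]_(n1 + n2)} :=
  (linfun (fun u : 'rV[L]_n1 => row_mx u (f u)) @: C1
   + linfun (fun v : 'rV[L]_n2 => row_mx 0 v) @: C2)%VS.

Lemma fsumP (n1 n2 : nat) (f : {linear 'rV[L]_n1 -> 'rV[L]_n2})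
    (C1 : {vspace 'rV[L]_n1}) (C2 : {vspace 'rV[L]_n2}) x :
  x \in fsum f C1 C2 <->
  exists u v, [/\ u \in C1, v \in C2 & x = row_mx u (f u + v)].
Proof.
have lg : linear (fun u : 'rV[L]_n1 => row_mx u (f u)).
  by move=> a u v; rewrite linearP scale_row_mx add_row_mx.
have lh : linear (fun v : 'rV[L]_n2 => row_mx (0 : 'rV[L]_n1) v).
  by move=> a u v; rewrite scale_row_mx add_row_mx scaler0 addr0.
pose gM := GRing.isLinear.Build _ _ _ _ _ lg.
pose g : {linear _ -> _} := HB.pack (fun u : 'rV[L]_n1 => row_mx u (f u)) gM.
pose hM := GRing.isLinear.Build _ _ _ _ _ lh.
pose h : {linear _ -> _} :=
  HB.pack (fun v : 'rV[L]_n2 => row_mx (0 : 'rV[L]_n1) v) hM.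
have gE u : linfun (fun u : 'rV[L]_n1 => row_mx u (f u)) u = row_mx u (f u).
  exact: (lfunE g).
have hE v : linfun (fun v : 'rV[L]_n2 => row_mx (0 : 'rV[L]_n1) v) v
    = row_mx 0 v by exact: (lfunE h).
split.
  case/memv_addP=> _ /memv_imgP[u uC ->] [_ /memv_imgP[v vC ->] ->].
  by exists u, v; split=> //; rewrite gE hE add_row_mx addr0.
case=> u [v [uC vC ->]].
apply/memv_addP; exists (row_mx u (f u)); first by rewrite -gE memv_img.
exists (row_mx 0 v); first by rewrite -hE memv_img.
by rewrite add_row_mx addr0.
Qed.

End RankMetric.

(* Main.v *)
(* Write a system as the column space of a generator matrix G.  Its rank
   saturation index is the least r such that every vector of L^k has the form
   G A c with A a matrix over F with r columns; this r is insensitive to left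
   multiplication of G by GL_k(L).  For the block matrix [G1, G1 A_f; 0, G2]
   generating the f-sum, solving first for the lower block and then for the
   upper one shows r <= rho1 + rho2.

   The bound on s(k, rho) asks for the value rho1 + rho2 exactly, so one also
   needs that every value between the index of a system and min(k, m) is
   attained by a system of no larger dimension.  Starting from G with k columns
   forming the identity, erase the remaining entries one by one: each step
   raises the index by at most one, and the last matrix is defined over F,
   where the index is min(k, m). *)
Require Import Defs.
From HB Require Import structures.
From mathcomp Require Import all_boot all_order all_algebra all_field.
From Stdlib Require Import Classical.

Set Implicit Arguments.
Unset Strict Implicit.
Unset Printing Implicit Defensive.

Import GRing.Theory.
Local Open Scope ring_scope.

Lemma ex_min_nat (P : nat -> Prop) :
  (exists n, P n) -> exists2 n, P n & forall m, P m -> (n <= m)%N.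
Proof.
case=> n; elim/ltn_ind: n => n IHn Pn.
have [[m lt_mn Pm]|minPn] := classic (exists2 m, (m < n)%N & P m).
  exact: IHn lt_mn Pm.
exists n => // m Pm; rewrite leqNgt; apply/negP=> lt_mn.
by case: minPn; exists m.
Qed.

(** * Spans of finite families *)

Section SpanFamily.
Variables (K : fieldType) (V : vectType K).

Lemma mem_span_family n (v : 'I_n -> V) x :
  x \in <<[seq v i | i : 'I_n]>>%VS <->
  exists c : 'I_n -> K, x = \sum_i c i *: v i.
Proof.
rewrite span_def big_image /=; split=> [/memv_sumP[w wv ->] | [c ->]].
  have /fin_all_exists[c wE] i : exists a, w i = a *: v i.
    by apply/vlineP/wv.
  by exists c; apply: eq_bigr.
by apply: memv_sumr => i _; rewrite memvZ ?memv_line.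
Qed.

Lemma free_familyP n (v : 'I_n -> V) :
  free [seq v i | i : 'I_n] <->
  forall c : 'I_n -> K, \sum_i c i *: v i = 0 -> forall i, c i = 0.
Proof.
pose t := [tuple v i | i < n].
have tE : t = [seq v i | i : 'I_n] :> seq V by [].
have nE c : \sum_i c i *: v i = \sum_(i < n) c i *: t`_i.
  by apply: eq_bigr => i _; rewrite -tnth_nth tnth_mktuple.
rewrite -tE; split=> [/freeP fr c | fr].
  by rewrite nE; apply: fr.
by apply/freeP=> c; rewrite -nE; apply: fr.
Qed.

Lemma dim_span_family n (v : 'I_n -> V) :
  (\dim <<[seq v i | i : 'I_n]>> <= n)%N.
Proof. by rewrite -[n in (_ <= n)%N]card_ord -(size_image v) dim_span. Qed.

Lemma dim_span_family_eq n (v : 'I_n -> V) :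
  \dim <<[seq v i | i : 'I_n]>> = n <->
  forall c : 'I_n -> K, \sum_i c i *: v i = 0 -> forall i, c i = 0.
Proof.
rewrite -free_familyP /free size_image card_ord.
by split=> [/eqP|/eqP].
Qed.

End SpanFamily.

Section RankCovering.
Variables (F : finFieldType) (L : fieldExtType F).

Local Notation "A ^L" := (map_mx (in_alg L) A) (at level 2, format "A ^L").

(** * Systems as column spaces of matrices *)

Lemma colvec_inj k : injective (@colvec F L k).
Proof.
by move=> u v /matrixP e; apply/ffunP=> i; move: (e i 0); rewrite !mxE.
Qed.

Lemma colvec_eq0 k (u : {ffun 'I_k -> L}) : (colvec u == 0) = (u == 0).
Proof.
rewrite -(inj_eq (@colvec_inj k)); congr (_ == _).
by apply/matrixP=> i j; rewrite !mxE ffunE.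
Qed.

Lemma colvecK k (x : 'cV[L]_k) : colvec [ffun i => x i 0] = x.
Proof. by apply/matrixP=> i j; rewrite !mxE ffunE ord1. Qed.

Lemma colvec_sum_columns n k (G : 'M[L]_(k, n)) (a : 'I_n -> F) :
  colvec (\sum_j a j *: [ffun i => G i j]) = G *m (\col_j a j)^L.
Proof.
apply/matrixP=> i j; rewrite !mxE sum_ffunE; apply: eq_bigr => l _.
by rewrite !ffunE !mxE mulr_algr.
Qed.

Lemma mem_column_space n k (G : 'M[L]_(k, n)) u :
  u \in column_space G <-> exists a : 'cV[F]_n, colvec u = G *m a^L.
Proof.
rewrite mem_span_family; split=> [[a ->] | [a ua]].
  by exists (\col_j a j); apply: colvec_sum_columns.
exists (fun j => a j 0); apply: colvec_inj; rewrite colvec_sum_columns ua.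
by congr (_ *m map_mx _ _); apply/matrixP=> i j; rewrite mxE ord1.
Qed.

Lemma dim_column_space n k (G : 'M[L]_(k, n)) :
  \dim (column_space G) = n <-> forall a : 'cV[F]_n, G *m a^L = 0 -> a = 0.
Proof.
rewrite dim_span_family_eq; split=> [fr a Ga0 | fr a Ga0 j].
  apply/matrixP=> j l; rewrite ord1 mxE; move: j.
  apply: fr; apply/eqP; rewrite -colvec_eq0 colvec_sum_columns -Ga0.
  by apply/eqP; congr (_ *m map_mx _ _); apply/matrixP=> i j; rewrite mxE ord1.
have /matrixP/(_ j 0) : \col_j a j = 0.
  apply: fr; rewrite -colvec_sum_columns Ga0.
  by apply/eqP; rewrite colvec_eq0.
by rewrite !mxE.
Qed.

Lemma row_free_solvable n k (G : 'M[L]_(k, n)) :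
  row_free G <-> forall x : 'cV[L]_k, exists y, x = G *m y.
Proof.
split=> [/row_freeP[H GH] x | sol].
  by exists (H *m x); rewrite mulmxA GH mul1mx.
have /fin_all_exists[h Gh] i : exists y, col i 1%:M = G *m y by [].
apply/row_freeP; exists (\matrix_(i, j) h j i 0).
apply/matrixP=> i j; have /matrixP/(_ i 0) := Gh j; rewrite !mxE => ->.
by apply: eq_bigr => l _; rewrite mxE.
Qed.

Lemma system_column_space n k (G : 'M[L]_(k, n)) s :
  row_free G -> \dim (column_space G) = s -> is_system s (column_space G).
Proof.
move=> /row_free_solvable sol dimG; split=> // x; have [y ->] := sol x.
exists [seq [ffun i => G i j] | j : 'I_n]; split=> [u|]; first exact: memv_span.
rewrite -map_comp; apply/mem_span_family; exists (fun j => y j 0).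
apply/matrixP=> i j; rewrite ord1 !mxE summxE; apply: eq_bigr => l _.
by rewrite !mxE ffunE mulrC.
Qed.

(** The columns of [G] are an [F]-basis of [U]. Since [U] spans over [L], any [x] is an
    [L]-combination of vectors [G *m a^L], hence of the form [G *m y]. *)
Lemma column_space_system n k (U : {vspace {ffun 'I_k -> L}}) :
  is_system n U -> exists2 G : 'M[L]_(k, n), row_free G & U = column_space G.
Proof.
case=> dimU spanU; subst n.
pose G := \matrix_(i < k, j < \dim U) (vbasis U)`_j i.
have UE : U = column_space G.
  rewrite -[LHS](span_basis (vbasisP U)) /column_space; congr span.
  apply: (@eq_from_nth _ 0) => [|i]; rewrite size_tuple.
    by rewrite size_image card_ord.
  move=> lt_i; rewrite (nth_map (Ordinal lt_i)) ?size_enum_ord //.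
  by apply/ffunP=> l; rewrite ffunE mxE nth_enum_ord.
exists G => //; apply/row_free_solvable=> x.
have [s [sU /(@coord_span _ _ _ (map_tuple _ (in_tuple s))) xE]] := spanU x.
have /fin_all_exists[a sE] (i : 'I_(size s)) :
    exists a : 'cV[F]_(\dim U), colvec s`_i = G *m a^L.
  by apply/mem_column_space; rewrite -UE sU ?mem_nth.
set c := coord _ in xE.
exists (\sum_i c i x *: (a i)^L); rewrite mulmx_sumr {1}xE.
by apply: eq_bigr => i _; rewrite -scalemxAr -sE (nth_map 0).
Qed.

(** * Covering by a bounded number of summands *)

(* [G *m A^L] lists [r] vectors of [column_space G], so [rank_sum G r x] says
   that [x] is an [L]-combination of [r] vectors of the system, repetitions and
   zeros allowed. *)
Definition rank_sum n k (G : 'M[L]_(k, n)) (r : nat) (x : 'cV[L]_k) : Prop :=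
  exists (A : 'M[F]_(n, r)) (c : 'cV[L]_r), x = G *m A^L *m c.

(** For [0 < k] the least such [r] is the rank saturation index. Unlike [covers], which demands
    distinct points and so fails once the linear set runs out of them, this condition is monotone in
    [r]. *)
Definition rank_covers n k (G : 'M[L]_(k, n)) (r : nat) : Prop :=
  forall x, rank_sum G r x.

Lemma rank_sum_family n k (G : 'M[L]_(k, n)) r x :
  rank_sum G r x <-> exists (a : 'I_r -> 'cV[F]_n) (c : 'I_r -> L),
    x = \sum_i c i *: (G *m (a i)^L).
Proof.
split=> [[A [c ->]] | [a [c ->]]].
  exists (fun i => col i A), (fun i => c i 0).
  apply/matrixP=> i j; rewrite ord1 !mxE summxE; apply: eq_bigr => l _.
  rewrite !mxE mulrC; congr (_ * _); apply: eq_bigr => h _.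
  by rewrite !mxE.
exists (\matrix_(i, j) a j i 0), (\col_i c i).
apply/matrixP=> i j; rewrite ord1 !mxE summxE; apply: eq_bigr => l _.
rewrite !mxE mulrC; congr (_ * _); apply: eq_bigr => h _.
by rewrite !mxE.
Qed.

Lemma rank_sumD n k (G : 'M[L]_(k, n)) r s x y :
  rank_sum G r x -> rank_sum G s y -> rank_sum G (r + s) (x + y).
Proof.
case=> A [c ->] [B [d ->]]; exists (row_mx A B), (col_mx c d).
by rewrite map_row_mx mul_mx_row mul_row_col.
Qed.

Lemma rank_sum0 n k (G : 'M[L]_(k, n)) r : rank_sum G r 0.
Proof. by exists 0, 0; rewrite mulmx0. Qed.

Lemma rank_sum_leq n k (G : 'M[L]_(k, n)) r s x :
  (r <= s)%N -> rank_sum G r x -> rank_sum G s x.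
Proof.
by move=> /subnKC <- rx; rewrite -[x]addr0; apply: rank_sumD (rank_sum0 _ _).
Qed.

Lemma rank_covers_leq n k (G : 'M[L]_(k, n)) r s :
  (r <= s)%N -> rank_covers G r -> rank_covers G s.
Proof. by move=> le_rs covG x; apply: rank_sum_leq le_rs _. Qed.

Lemma rank_covers_mull n k (P : 'M[L]_k) (G : 'M[L]_(k, n)) r :
  P \in unitmx -> rank_covers G r -> rank_covers (P *m G) r.
Proof.
move=> uP covG x; have [A [c xE]] := covG (invmx P *m x).
by exists A, c; rewrite -2!mulmxA [G *m _]mulmxA -xE mulKVmx.
Qed.

(** * Coverings and saturation of the linear set *)

Lemma linear_set_sum n k (G : 'M[L]_(k, n)) (t : seq {vspace 'cV[L]_k}) x :
    {in t, forall Q, linear_set (column_space G) Q} ->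
  x \in (\sum_(Q <- t) Q)%VS -> rank_sum G (size t) x.
Proof.
elim: t x => [|Q t IHt] x tG.
  by rewrite big_nil memv0 => /eqP ->; apply: rank_sum0.
rewrite big_cons => /memv_addP[y Qy [z tz ->]].
apply: (@rank_sumD _ _ _ 1); last first.
  by apply: IHt tz => R tR; apply: tG; rewrite inE tR orbT.
have [|u [/mem_column_space[a uE] _ QE]] := tG Q; first exact: mem_head.
move: Qy; rewrite QE => /vlineP[b ->].
apply/rank_sum_family; exists (fun=> a), (fun=> b).
by rewrite big_ord1 uE.
Qed.

(** Zero summands are discarded and proportional ones merged into one point, so fewer than [r]
    points may remain. *)
Lemma rank_sum_linear_set n k (G : 'M[L]_(k, n)) r x :
  rank_sum G r x -> exists t : seq {vspace 'cV[L]_k},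
    [/\ uniq t, (size t <= r)%N,
        {in t, forall Q, linear_set (column_space G) Q}
      & x \in (\sum_(Q <- t) Q)%VS].
Proof.
case/rank_sum_family=> a [c ->].
pose line i := <[G *m (a i)^L]>%VS.
pose s := [seq line i | i : 'I_r].
exists (undup [seq Q <- s | Q != 0%VS]); split.
- exact: undup_uniq.
- apply: leq_trans (size_undup _) _; rewrite size_filter.
  by apply: leq_trans (count_size _ _) _; rewrite size_image card_ord.
- move=> Q; rewrite mem_undup mem_filter => /andP[nzQ /imageP[i _ QE]].
  exists [ffun l => (G *m (a i)^L) l 0]; rewrite colvecK; split=> //.
    by apply/mem_column_space; exists (a i); rewrite colvecK.
  rewrite -colvec_eq0 colvecK; apply: contraNneq nzQ => a0.
  by rewrite QE /line a0.
apply: rpred_sum => i _; apply: rpredZ.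
have [->|nza] := eqVneq (G *m (a i)^L) 0; first exact: rpred0.
have: line i \in undup [seq Q <- s | Q != 0%VS].
  rewrite mem_undup mem_filter image_f // andbT.
  by apply: contraNneq nza => l0; rewrite -memv0 -l0 memv_line.
move=> /(@big_rem _ _ _ _ _ _ (fun=> true) id) ->.
by apply: (subvP (addvSl _ _)); apply: memv_line.
Qed.

Lemma covers_rank_covers n k (G : 'M[L]_(k, n)) r :
  covers r (linear_set (column_space G)) -> rank_covers G r.+1.
Proof.
move=> covG x; have [->|nzx] := eqVneq x 0; first exact: rank_sum0.
have [|t [_ tG xt]] := covG <[x]>%VS; first by rewrite dim_vline nzx.
by rewrite -(size_tuple t); apply: linear_set_sum tG _; rewrite memvE.
Qed.

Lemma rank_saturating_rank_covers n k (G : 'M[L]_(k, n)) r :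
  rank_saturating r (column_space G) -> rank_covers G r.
Proof. by case: r => [|r] [] // _ [/covers_rank_covers]. Qed.

(* A vector needing exactly [r] summands yields [r] distinct points of the
   linear set; they serve to pad every shorter family to [r] distinct points. *)
Lemma min_rank_covers_saturating n k (G : 'M[L]_(k, n)) r :
    (0 < k)%N -> rank_covers G r ->
    (forall s, rank_covers G s -> (r <= s)%N) ->
  rank_saturating r (column_space G).
Proof.
move=> k_gt0 covG minr.
have r_gt0 : (0 < r)%N.
  rewrite lt0n; apply/eqP=> r0; have [A [c]] := covG (const_mx 1).
  subst r; rewrite [c]flatmx0 mulmx0 => /matrixP/(_ (Ordinal k_gt0) 0) /eqP.
  by rewrite !mxE oner_eq0.
split=> //; split=> [W dimW | s /covers_rank_covers/minr]; last first.
  by case: r {covG minr} r_gt0.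
have [y ny] : exists y, ~ rank_sum G r.-1 y.
  apply: not_all_ex_not => covG'; have := minr _ covG'.
  by rewrite leqNgt ltn_predL r_gt0.
have [t0 [uniq_t0 size_t0 t0G yt0]] := rank_sum_linear_set (covG y).
have {y ny yt0} size_t0r : size t0 = r.
  apply/eqP; rewrite eqn_leq size_t0 leqNgt; apply/negP=> lt_t0.
  apply: ny; apply: rank_sum_leq (linear_set_sum t0G yt0).
  by rewrite -ltnS prednK.
have [t [uniq_t size_t tG xt]] := rank_sum_linear_set (covG (vpick W)).
(* At most [size t] points of [t0] lie in [t], so at least [r - size t] are left for padding. *)
pose t1 := take (r - size t) [seq Q <- t0 | Q \notin t].
have size_t1 : size t1 = (r - size t)%N.
  apply: size_takel; rewrite leq_subLR -{1}size_t0r.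
  rewrite -(count_predC [in t] t0) -!size_filter leq_add2r.
  apply: uniq_leq_size; first exact: filter_uniq.
  by move=> Q; rewrite mem_filter => /andP[].
have t1P Q : Q \in t1 -> (Q \notin t) && (Q \in t0).
  by move/mem_take; rewrite mem_filter.
have sz : size (t ++ t1) == r.-1.+1 by rewrite size_cat size_t1 subnKC ?prednK.
exists (Tuple sz); split=> /=.
- rewrite cat_uniq uniq_t take_uniq ?filter_uniq // andbT.
  by apply/hasPn=> Q /t1P/andP[].
- by move=> Q; rewrite mem_cat => /orP[/tG|/t1P/andP[_ /t0G]].
rewrite big_cat /=; apply: subv_trans (addvSl _ _).
have nzW : W != 0%VS by rewrite -dimv_eq0 dimW.
have <- : <[vpick W]>%VS = W; last by rewrite -memvE.
by apply/eqP; rewrite eqEdim -memvE memv_pick dimW dim_vline vpick0 nzW.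
Qed.

Lemma rank_covers_saturating n k (G : 'M[L]_(k, n)) r :
    (0 < r)%N -> rank_covers G r ->
  exists2 s, (s <= r)%N & rank_saturating s (column_space G).
Proof.
move=> r_gt0 covG; have [s covs mins] := ex_min_nat (ex_intro _ r covG).
have [k0|k_gt0] := posnP k; last first.
  exists s; [exact: mins | exact: min_rank_covers_saturating].
(* For [k = 0] there are no projective points: covering is vacuous, and positivity makes the index
   1. *)
subst k; exists 1%N => //; split=> //; split=> // W dimW.
by have := dimvS (subvf W); rewrite dimW dimvf /dim /= mul0n.
Qed.

(** * Block matrices and generator matrices of f-sums *)

Lemma rank_covers_block n1 n2 k1 k2 (G1 : 'M[L]_(k1, n1)) (G2 : 'M[L]_(k2, n2))
    (B : 'M[L]_(k1, n2)) r1 r2 :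
  rank_covers G1 r1 -> rank_covers G2 r2 ->
  rank_covers (block_mx G1 B 0 G2) (r1 + r2).
Proof.
move=> cov1 cov2 x; have [A2 [c2 x2E]] := cov2 (dsubmx x).
(* The lower coefficients contribute [B *m A2^L *m c2] to the upper block, so this is subtracted
   from the upper target. *)
have [A1 [c1 x1E]] := cov1 (usubmx x - B *m A2^L *m c2).
exists (block_mx A1 0 0 A2), (col_mx c1 c2).
rewrite map_block_mx !map_mx0 mulmx_block !mulmx0 !mul0mx !addr0 !add0r.
by rewrite mul_block_col mul0mx add0r -x1E -x2E subrK vsubmxK.
Qed.

Lemma row_free_block n1 n2 k1 k2 (G1 : 'M[L]_(k1, n1)) (G2 : 'M[L]_(k2, n2))
    (B : 'M[L]_(k1, n2)) :
  row_free G1 -> row_free G2 -> row_free (block_mx G1 B 0 G2).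
Proof.
move=> /row_free_solvable sol1 /row_free_solvable sol2.
apply/row_free_solvable=> x; have [y2 x2E] := sol2 (dsubmx x).
have [y1 x1E] := sol1 (usubmx x - B *m y2).
exists (col_mx y1 y2).
by rewrite mul_block_col mul0mx add0r -x1E -x2E subrK vsubmxK.
Qed.

Lemma dim_column_space_block n1 n2 k1 k2 (G1 : 'M[L]_(k1, n1))
    (G2 : 'M[L]_(k2, n2)) (B : 'M[L]_(k1, n2)) :
  \dim (column_space G1) = n1 -> \dim (column_space G2) = n2 ->
  \dim (column_space (block_mx G1 B 0 G2)) = (n1 + n2)%N.
Proof.
rewrite !dim_column_space => fr1 fr2 a.
rewrite -[a]vsubmxK map_col_mx mul_block_col mul0mx add0r -[0]vsubmxK.
case/eq_col_mx; rewrite !linear0 => a1 a2; move: a1.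
by rewrite (fr2 _ a2) map_mx0 mulmx0 addr0 => /fr1 ->; rewrite col_mx0.
Qed.

Lemma dim_column_space_mull n k (P : 'M[L]_k) (G : 'M[L]_(k, n)) :
  P \in unitmx -> \dim (column_space G) = n ->
  \dim (column_space (P *m G)) = n.
Proof.
move=> uP; rewrite !dim_column_space => fr a PGa; apply: fr.
by rewrite -(mulKmx uP (G *m _)) [P *m _]mulmxA PGa mulmx0.
Qed.

Lemma generator_matrixP n k (C : {vspace 'rV[L]_n}) (G : 'M[L]_(k, n)) :
  generator_matrix C G <-> row_free G /\ forall v, v \in C <-> (v <= G)%MS.
Proof.
have spanE v : v \in <<[seq row i G | i : 'I_k]>>%VS <-> (v <= G)%MS.
  rewrite mem_span_family; split=> [[c ->] | /submxP[c ->]].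
    apply/submxP; exists (\row_i c i); rewrite mulmx_sum_row.
    by apply: eq_bigr => i _; rewrite mxE.
  by exists (fun i => c 0 i); rewrite mulmx_sum_row.
have freeE : free [seq row i G | i : 'I_k] <-> row_free G.
  rewrite free_familyP; split=> [fr | frG c].
    rewrite -kermx_eq0; apply/rowV0P=> c /sub_kermxP.
    rewrite mulmx_sum_row => /fr c0.
    by apply/rowP=> i; rewrite c0 mxE.
  have <- : \row_i c i *m G = \sum_i c i *: row i G.
    by rewrite mulmx_sum_row; apply: eq_bigr => i _; rewrite mxE.
  rewrite -(mul0mx 1 G) => /(row_free_inj frG)/rowP c0 i.
  by move: (c0 i); rewrite !mxE.
rewrite /generator_matrix /basis_of; split=> [/andP[/eqP <- /freeE frG] | ].
  by split.
case=> /freeE -> CG; rewrite andbT; apply/eqP/vspaceP=> v.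
by apply/idP/idP => [/spanE/CG | /CG/spanE].
Qed.

Lemma generator_matrix_unique n k (C : {vspace 'rV[L]_n}) (G H : 'M[L]_(k, n)) :
    generator_matrix C G -> generator_matrix C H ->
  exists2 P, P \in unitmx & H = P *m G.
Proof.
case/generator_matrixP=> _ CG /generator_matrixP[frH CH].
have /submxP[P HE] : (H <= G)%MS.
  by apply/row_subP=> i; apply/CG/CH; apply: row_sub.
(* [P] is invertible because [k], the rank of [H = P *m G], is at most the rank of [P]. *)
exists P => //; rewrite -row_free_unit /row_free eqn_leq rank_leq_row.
by move: frH; rewrite HE => /eqP {1}<-; apply: mxrankM_maxl.
Qed.

(** A coefficient row splits as [(a, b)]: [a *m G1] is the word [u], [b *m G2] is [v], and the upper
    right block produces [f u]. *)
Lemma fsum_generator_matrix n1 n2 k1 k2 (f : {linear 'rV[L]_n1 -> 'rV[L]_n2})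
    (C1 : {vspace 'rV[L]_n1}) (C2 : {vspace 'rV[L]_n2})
    (G1 : 'M[L]_(k1, n1)) (G2 : 'M[L]_(k2, n2)) :
    generator_matrix C1 G1 -> generator_matrix C2 G2 ->
  generator_matrix (fsum f C1 C2) (block_mx G1 (G1 *m lin1_mx f) 0 G2).
Proof.
case/generator_matrixP=> fr1 CG1 /generator_matrixP[fr2 CG2].
apply/generator_matrixP; split=> [|v]; first exact: row_free_block.
rewrite fsumP; split.
  case=> u [w [/CG1/submxP[a ->] /CG2/submxP[b ->] ->]].
  apply/submxP; exists (row_mx a b).
  by rewrite mul_row_block mulmx0 addr0 mulmxA mul_rV_lin1.
case/submxP=> a ->; exists (lsubmx a *m G1), (rsubmx a *m G2); split.
- by apply/CG1; apply: submxMl.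
- by apply/CG2; apply: submxMl.
by rewrite -{1}[a]hsubmxK mul_row_block mulmx0 addr0 mulmxA mul_rV_lin1.
Qed.

(** * Systems of prescribed saturation index *)

(** The correction contributes only [L]-multiples of [G *m a^L], a single vector of the system of
    [G], so one extra summand absorbs it. *)
Lemma rank_covers_perturb n k (G H : 'M[L]_(k, n)) (a : 'cV[F]_n)
    (b : 'rV[L]_n) r :
  H = G + G *m a^L *m b -> rank_covers H r -> rank_covers G r.+1.
Proof.
move=> HE covH x; have [A [c ->]] := covH x.
rewrite HE -mulmxA mulmxDl -addn1; apply: rank_sumD.
  by exists A, c; rewrite mulmxA.
by exists a, (b *m (A^L *m c)); rewrite !mulmxA.
Qed.

(** The target's coordinates start with an [F]-basis of [L]. With [T] over [F] they are
    [F]-combinations of the [r] entries of [c], so at most [r] of them are independent. *)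
Lemma rank_covers_base_field n k (T : 'M[F]_(k, n)) r :
  rank_covers T^L r -> (minn k (\dim {:L}) <= r)%N.
Proof.
move=> covT; pose b := vbasis {:L}.
(* If [k] exceeds the degree of [L], the default value 0 fills the remaining coordinates. *)
have [A [c xE]] := covT (\col_(i < k) b`_i).
have fb : free (take k b).
  have := basis_free (vbasisP {:L}).
  by rewrite -{1}(cat_take_drop k (vbasis _)) => /catl_free.
have <- : size (take k b) = minn k (\dim {:L}).
  by rewrite size_take_min size_tuple.
rewrite -(eqP fb); apply: leq_trans (dim_span_family (fun i => c i 0)).
apply/dimvS/span_subvP=> _ /(nthP 0)[i + <-].
rewrite size_take_min leq_min => /andP[ltik _]; rewrite nth_take //.
have /matrixP/(_ (Ordinal ltik) 0) := xE; rewrite -map_mxM !mxE /= => ->.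
apply/mem_span_family; exists ((T *m A) (Ordinal ltik)).
by apply: eq_bigr => l _; rewrite mxE mulr_algl.
Qed.

(** Choose [k] independent columns and multiply by the inverse of the submatrix they form. *)
Lemma row_free_normalize n k (G : 'M[L]_(k, n)) : row_free G ->
  exists (P : 'M[L]_k) (f : 'I_k -> 'I_n),
    [/\ P \in unitmx, injective f &
        forall i l, (P *m G) i (f l) = (i == l)%:R].
Proof.
move=> frG; have rfG : row_full G^T by rewrite /row_full mxrank_tr.
pose f := fullrankfun rfG.
have uS : colsub f G \in unitmx.
  by rewrite -unitmx_tr trmx_mxsub; apply: fullrowsub_unit.
exists (invmx (colsub f G)), f; split.
- by rewrite unitmx_inv.
- exact: fullrankfun_inj.
move=> i l; have /matrixP/(_ i l) := mulVmx uS.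
by rewrite mulmx_colsub mxE [RHS]mxE.
Qed.

(** A discrete intermediate value argument: if no matrix had index exactly [r], the bound [r.-1]
    would persist along the whole erasure and contradict [rank_covers_base_field] at its end. *)
Lemma rank_covers_exact n k (G : 'M[L]_(k, n)) r :
    row_free G -> rank_covers G r ->
    (0 < r <= minn k (\dim {:L}))%N ->
  exists G' : 'M[L]_(k, n),
    [/\ row_free G', rank_covers G' r & ~ rank_covers G' r.-1].
Proof.
move=> frG covG /andP[r_gt0 r_le]; apply: NNPP => noG'.
have {noG'} drop (G' : 'M[L]_(k, n)) :
    row_free G' -> rank_covers G' r -> rank_covers G' r.-1.
  by move=> fr' cov'; apply: NNPP => ncov; apply: noG'; exists G'.
have [P [f [uP injf Pf]]] := row_free_normalize frG.
have {covG} covPG := rank_covers_mull uP covG.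
move: (P *m G) Pf covPG => H Pf covPG.
(* Erase the first [t] entries, except in the identity columns. *)
pose M t : 'M[L]_(k, n) := \matrix_(i, j)
  if (j \in codom f) || (t <= enum_rank (i, j))%N then H i j else 0.
have Mf t i l : M t i (f l) = (i == l)%:R by rewrite mxE codom_f Pf.
(* Every unit vector stays in the system of [M t], so changing one entry is a perturbation by a
   vector of that system. *)
have Mdelta t l : M t *m (delta_mx (f l) (0 : 'I_1))^L = delta_mx l 0.
  rewrite map_delta_mx -colE; apply/matrixP=> i j.
  by rewrite mxE Mf mxE ord1 eqxx andbT.
have frM t : row_free (M t).
  apply/row_freeP; exists (\matrix_(j, l) (j == f l)%:R).
  apply/matrixP=> i l; rewrite !mxE (bigD1 (f l)) //= mxE eqxx mulr1.
  rewrite Mf big1 ?addr0 // => j /negPf jl.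
  by rewrite !mxE jl mulr0.
have covM t : (t <= #|{: 'I_k * 'I_n}|)%N -> rank_covers (M t) r.-1.
  elim: t => [_|t IHt lt_t]; apply: drop => //.
    have -> // : M 0%N = H.
    by apply/matrixP=> i j; rewrite mxE leq0n orbT.
  rewrite -(prednK r_gt0); have := IHt (ltnW lt_t).
  case e: (enum_val (Ordinal lt_t)) => [i0 j0].
  have rk0 : enum_rank (i0, j0) = t :> nat by rewrite -e enum_valK.
  (* [h] is the difference between [M t] and [M t.+1] at [(i0, j0)]; it is 0 in an identity column,
     where nothing is erased. *)
  pose h := if j0 \in codom f then 0 else H i0 j0.
  apply: (@rank_covers_perturb _ _ _ _ (delta_mx (f i0) 0)
            (h *: delta_mx 0 j0)).
  rewrite Mdelta -scalemxAr mul_delta_mx; apply/matrixP=> i j.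
  rewrite !mxE; have [[-> ->]|ne] := eqVneq (i, j) (i0, j0).
    rewrite !eqxx rk0 leqnn ltnn orbT orbF mulr1 /h.
    by case: (j0 \in codom f); rewrite ?addr0 ?add0r.
  have -> : (i == i0) && (j == j0) = false by apply: negPf; rewrite -xpair_eqE.
  rewrite mulr0 addr0 leq_eqVlt (_ : t == _ = false) //.
  by apply: contraNF ne => /eqP/esym; rewrite -rk0 => /ord_inj/enum_rank_inj ->.
have := covM _ (leqnn _).
(* Once every position is passed, only the identity columns survive, with entries 0 and 1 from
   [F]. *)
have -> : M #|{: 'I_k * 'I_n}| = (\matrix_(i, j) (f i == j)%:R)^L.
  apply/matrixP=> i j; rewrite !mxE leqNgt ltn_ord orbF.
  case: ifP => [/codomP[l ->]|njf].
    by rewrite Pf (inj_eq injf) rmorph_nat.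
  rewrite (_ : f i == j = false) ?rmorph0 //.
  by apply: contraFF njf => /eqP <-; apply: codom_f.
move/rank_covers_base_field/(leq_trans r_le).
by rewrite leqNgt ltn_predL r_gt0.
Qed.

(** Erasure can make columns dependent over [F], so the dimension may fall below [n]; hence only
    [s <= n]. *)
Lemma ex_saturating_system n k (G : 'M[L]_(k, n)) r :
    row_free G -> rank_covers G r ->
    (0 < r <= minn k (\dim {:L}))%N ->
  exists2 s, (s <= n)%N & exists U : {vspace {ffun 'I_k -> L}},
    is_system s U /\ rank_saturating r U.
Proof.
move=> frG covG r_bnd.
have [H [frH covH ncovH]] := rank_covers_exact frG covG r_bnd.
exists (\dim (column_space H)); first exact: dim_span_family.
exists (column_space H); split; first exact: system_column_space.
have /andP[r_gt0] := r_bnd; rewrite leq_min => /andP[le_rk _].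
apply: min_rank_covers_saturating => // [|s covs]; first exact: leq_trans le_rk.
rewrite leqNgt; apply/negP=> lt_sr; apply: ncovH.
by apply: rank_covers_leq covs; rewrite -ltnS prednK.
Qed.

Lemma ex_min_saturating n k r (U : {vspace {ffun 'I_k -> L}}) :
    is_system n U -> rank_saturating r U ->
  exists2 s, is_min_saturating L k r s & (s <= n)%N.
Proof.
move=> sysU satU.
pose P n := exists V : {vspace {ffun 'I_k -> L}},
  is_system n V /\ rank_saturating r V.
have Pn : P n by exists U.
have [s Ps mins] := ex_min_nat (ex_intro P n Pn).
exists s; last exact: mins.
by split=> // n' V sysV satV; apply: mins; exists V.
Qed.

End RankCovering.

Theorem theorem3p8 (q m : nat) (F : finFieldType) (L : fieldExtType F)
  (hq : #|F| = q) (hm : \dim {:L} = m)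
  (n1 k1 rho1 n2 k2 rho2 : nat)
  (C1 : {vspace 'rV[L]_n1}) (C2 : {vspace 'rV[L]_n2})
  (hC1 : is_code k1 C1) (hC2 : is_code k2 C2)
  (nd1 : nondegenerate_code k1 C1) (nd2 : nondegenerate_code k2 C2)
  (U1 : {vspace {ffun 'I_k1 -> L}}) (U2 : {vspace {ffun 'I_k2 -> L}})
  (hU1 : is_system n1 U1) (hU2 : is_system n2 U2)
  (aU1 : associated_system C1 U1) (aU2 : associated_system C2 U2)
  (sU1 : rank_saturating rho1 U1) (sU2 : rank_saturating rho2 U2)
  (f : {linear 'rV[L]_n1 -> 'rV[L]_n2}) :
  [/\ exists U : {vspace {ffun 'I_(k1 + k2) -> L}},
        associated_system (fsum f C1 C2) U,
      forall U : {vspace {ffun 'I_(k1 + k2) -> L}},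
        associated_system (fsum f C1 C2) U ->
        is_system (n1 + n2) U /\
        exists2 rho : nat, (rho <= rho1 + rho2)%N & rank_saturating rho U
    & (rho1 + rho2 <= minn (k1 + k2) m)%N ->
      exists s1 s2 s : nat,
        [/\ is_min_saturating L k1 rho1 s1,
            is_min_saturating L k2 rho2 s2,
            is_min_saturating L (k1 + k2) (rho1 + rho2) s
          & (s <= s1 + s2)%N]].
Proof.
have rho_gt0 : (0 < rho1 + rho2)%N by rewrite addn_gt0; case: sU1 => ->.
have [G1 [genG1 U1E]] := aU1; have [G2 [genG2 U2E]] := aU2.
have genG := fsum_generator_matrix f genG1 genG2.
split.
- by eexists; eexists; split; first exact: genG.
(* Any generator matrix of the f-sum is the block matrix multiplied on the left by an invertible
   [P], which preserves dimension and covering. *)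
- move=> U [H [genH ->]]; have [P uP HE] := generator_matrix_unique genG genH.
  have dimH : \dim (column_space H) = (n1 + n2)%N.
    rewrite HE; apply: dim_column_space_mull => //.
    apply: dim_column_space_block; rewrite -?U1E -?U2E.
      by case: hU1.
    by case: hU2.
  split; first by apply: system_column_space dimH; case/generator_matrixP: genH.
  apply: rank_covers_saturating => //; rewrite HE; apply: rank_covers_mull => //.
  apply: rank_covers_block; apply: rank_saturating_rank_covers.
    by rewrite -U1E.
  by rewrite -U2E.
rewrite -hm => rho_le.
have [s1 min1 _] := ex_min_saturating hU1 sU1.
have [s2 min2 _] := ex_min_saturating hU2 sU2.
have [[V1 [sysV1 satV1]] _] := min1; have [[V2 [sysV2 satV2]] _] := min2.
have [H1 fr1 V1E] := column_space_system sysV1.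
have [H2 fr2 V2E] := column_space_system sysV2.
rewrite V1E in satV1; rewrite V2E in satV2.
(* Optimal systems are joined block-diagonally. The resulting index may be below [rho1 + rho2], so
   [ex_saturating_system] then supplies a system with exactly that value. *)
have covH := rank_covers_block 0 (rank_saturating_rank_covers satV1)
  (rank_saturating_rank_covers satV2).
have [|n le_n [U [sysU satU]]] :=
    ex_saturating_system (row_free_block 0 fr1 fr2) covH.
  by rewrite rho_gt0.
have [s mins le_s] := ex_min_saturating sysU satU.
by exists s1, s2, s; split=> //; apply: leq_trans le_n.
Qed.
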